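(* Let $n\in\mathbb{N}$, $n\ge 1$, let $\boldsymbol\gamma^1,\ldots,\boldsymbol\gamma^n\in\mathbb{D}^2$ be pairwise distinct, and let $F:\mathbb{R}^2\to\mathbb{C}$. Then the following are equivalent: (i) for all $t_1,\ldots,t_n\in(0,\infty)$ and all $\mathbf{v}^1,\ldots,\mathbf{v}^n\in\mathbb{U}$ (that is, for all choices of vectors $t_i\mathbf{v}^i\in\mathbb{R}^2\setminus\{\mathbf{0}\}$, $i=1,\ldots,n$), $$\Delta_{t_1\mathbf{v}^1}^{\boldsymbol\gamma^1}\,\Delta_{t_2\mathbf{v}^2}^{\boldsymbol\gamma^2}\cdots\Delta_{t_n\mathbf{v}^n}^{\boldsymbol\gamma^n}F(\mathbf{z})=0\quad\text{for all }\mathbf{z}\in\mathbb{R}^2;$$ (ii) there exist $c_1,\ldots,c_n\in\mathbb{C}$ such that $$F(\mathbf{z})=\sum_{\ell=1}^n c_\ell\exp\big((\boldsymbol\gamma^\ell)^T\mathbf{z}\big)\quad\text{for all }\mathbf{z}\in\mathbb{R}^2.$$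
   Context: Vectors are column vectors and $^T$ denotes the transpose (no complex conjugation). $\imath$ is the imaginary unit, $\mathbb{D}:=\mathbb{R}\cup\imath(-\pi,\pi)\subset\mathbb{C}$ (each component of a vector in $\mathbb{D}^2$ is either real or purely imaginary with modulus less than $\pi$). $\mathbb{U}:=\{\mathbf{u}\in\mathbb{R}^2: |\mathbf{u}|=1\}$, where $|\cdot|$ is the Euclidean norm. For $F:\mathbb{R}^2\to\mathbb{C}$, $\mathbf{v}\in\mathbb{U}$, $\boldsymbol\gamma\in\mathbb{D}^2$ and $t>0$, the difference operator is $$\Delta_{t\mathbf{v}}^{\boldsymbol\gamma}F(\mathbf{z}):=F(\mathbf{z}+t\mathbf{v})-\exp(\boldsymbol\gamma^T\mathbf{v}\,t)\,F(\mathbf{z}),\qquad \mathbf{z}\in\mathbb{R}^2.$$ A product of such operators denotes their composition. *)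

(* Defs.v *)
From mathcomp Require Import all_boot all_order all_algebra.
From mathcomp Require Import complex.
From mathcomp Require Import reals.
From mathcomp.analysis Require Import sequences exp trigo.

Set Implicit Arguments.
Unset Strict Implicit.
Unset Printing Implicit Defensive.

Import Order.TTheory GRing.Theory Num.Theory.
Local Open Scope ring_scope.
Local Open Scope complex_scope.

Definition cexp (R : realType) (z : R[i]) : R[i] :=
  (expR (complex.Re z) * cos (complex.Im z)) +i* (expR (complex.Re z) * sin (complex.Im z)).

Definition inD (R : realType) (z : R[i]) : bool :=
  (complex.Im z == 0) || ((complex.Re z == 0) && (- pi < complex.Im z < pi)).

(* The norm that the library puts on matrices is the sup norm. *)
Definition enorm (R : realType) (v : 'cV[R]_2) : R :=
  Num.sqrt (\sum_(i < 2) v i 0 ^+ 2).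

(* The bilinear product g^T z, with no conjugation. *)
Definition cdot (R : realType) (g : 'cV[R[i]]_2) (z : 'cV[R]_2) : R[i] :=
  (g^T *m map_mx (real_complex R) z) 0 0.

Definition Delta (R : realType) (g : 'cV[R[i]]_2) (v : 'cV[R]_2) (t : R)
    (F : 'cV[R]_2 -> R[i]) : 'cV[R]_2 -> R[i] :=
  fun z => F (z + t *: v) - cexp (cdot g v * t%:C) * F z.

(* Main.v *)
Require Import Defs.
From HB Require Import structures.
From mathcomp Require Import all_boot all_order all_algebra.
From mathcomp Require Import complex.
From mathcomp Require Import boolp reals.
From mathcomp.analysis Require Import sequences exp trigo.
From mathcomp Require Import ring.

Set Implicit Arguments.
Unset Strict Implicit.
Unset Printing Implicit Defensive.

Import Order.TTheory GRing.Theory Num.Theory.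
Local Open Scope ring_scope.
Local Open Scope complex_scope.

(** The equivalence is purely algebraic: it holds for characters, that is,
homomorphisms from an additive group to the multiplicative group of a field,
and for an arbitrary function [F]. The maps [z |-> cexp (cdot g z)] are
characters of the plane, distinct for distinct [g], and the steps [t *: v] with
[0 < t] and [v] of norm one are exactly the nonzero vectors. So let
[chi_1, ..., chi_n] be distinct characters, and write [D_h] for the operator
that sends [F] to [z |-> F (z + h) - chi_n h * F z].

If [F] is a combination of the characters, then [D_h F] is a combination of
[chi_1, ..., chi_(n-1)] alone ([diffop_sum]), and induction on [n] shows that
the product of operators kills [F] ([diffops_sum_eq0]).

Conversely ([exp_sum_of_diffops_eq0]), if all the products kill [F], then by
induction, for every [h], [D_h F = \sum_(l < n) c_l(h) chi_l]. Since [D_h] and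
[D_k] commute, comparing coefficients in [D_k (D_h F) = D_h (D_k F)] gives
[c_l(h) (chi_l k - chi_n k) = c_l(k) (chi_l h - chi_n h)]; this comparison is
legitimate because distinct characters are linearly independent
([character_free], due to Dedekind and Artin). Fixing a [k] that separates
[chi_l] from [chi_n] yields a constant [d_l] with
[c_l(h) = d_l (chi_l h - chi_n h)] for all [h]. Hence every [D_h] kills
[F - \sum_(l < n) d_l chi_l], which is therefore a multiple of [chi_n]. *)

(** * Composition of a finite family of maps *)

(** With this monoid structure the innermost map of an iterated composition can
be split off, which is what both inductions below do. *)
HB.instance Definition _ (T : Type) :=
  Monoid.isLaw.Build (T -> T) id (@comp T T T)
    (fun f g h => erefl) (fun f => erefl) (fun f => erefl).

(** * Characters of an abelian group and their difference operators *)

Section Characters.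
Variables (V : zmodType) (K : fieldType).
Implicit Types (chi : V -> K) (F : V -> K) (h k z : V).

Definition is_character chi :=
  chi 0 = 1 /\ {morph chi : x y / x + y >-> x * y}.

Definition separated n (chi : 'I_n -> V -> K) :=
  forall k l : 'I_n, k <> l -> exists h, chi k h != chi l h.

Definition diffop chi h F : V -> K := fun z => F (z + h) - chi h * F z.

(** Each character [psi l] is an eigenvector of the difference operator, with
eigenvalue [psi l h - chi h]; in particular [chi] itself is killed. *)
Lemma diffop_sum chi h n (psi : 'I_n -> V -> K) (a : 'I_n -> K) :
  (forall l, is_character (psi l)) ->
  diffop chi h (fun z => \sum_(l < n) a l * psi l z) =
  (fun z => \sum_(l < n) a l * (psi l h - chi h) * psi l z).
Proof.
move=> psiP; apply/funext => z; rewrite /diffop mulr_sumr -sumrB.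
by apply: eq_bigr => l _; rewrite (psiP l).2; ring.
Qed.

Lemma diffop_sum_last h n (chi : 'I_n.+1 -> V -> K) (a : 'I_n.+1 -> K) :
  (forall l, is_character (chi l)) ->
  diffop (chi ord_max) h (fun z => \sum_(l < n.+1) a l * chi l z) =
  (fun z => \sum_(l < n) a (widen_ord (leqnSn n) l) *
      (chi (widen_ord (leqnSn n) l) h - chi ord_max h) *
      chi (widen_ord (leqnSn n) l) z).
Proof.
move=> chiP; rewrite diffop_sum //; apply/funext => z.
by rewrite big_ord_recr /= subrr mulr0 mul0r addr0.
Qed.

Lemma diffopC chi h k F :
  diffop chi h (diffop chi k F) = diffop chi k (diffop chi h F).
Proof. by apply/funext => z; rewrite /diffop (addrAC z h k); ring. Qed.

Lemma diffop0 chi F : is_character chi -> diffop chi 0 F = fun=> 0.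
Proof.
by move=> [chi0 _]; apply/funext => z; rewrite /diffop addr0 chi0 mul1r subrr.
Qed.

Lemma diffop_all_eq0 chi F :
  (forall h z, diffop chi h F z = 0) -> forall z, F z = F 0 * chi z.
Proof.
move=> F0 z; have /eqP := F0 z 0.
by rewrite /diffop add0r subr_eq0 mulrC => /eqP.
Qed.

Lemma separated_widen n (chi : 'I_n.+1 -> V -> K) :
  separated chi -> separated (fun l => chi (widen_ord (leqnSn n) l)).
Proof. by move=> sep k l kl; apply: sep => /(congr1 val) /= /val_inj. Qed.

Lemma separated_last n (chi : 'I_n.+1 -> V -> K) : separated chi ->
  forall l : 'I_n, exists h, chi (widen_ord (leqnSn n) l) h != chi ord_max h.
Proof.
move=> sep l; apply: sep => /(congr1 val) /= ln.
by have := ltn_ord l; rewrite ln ltnn.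
Qed.

(** Applying the difference operator of the last character to a vanishing
combination removes that character and multiplies the other coefficients by
factors that can be made nonzero one at a time. *)
Lemma character_free n (chi : 'I_n -> V -> K) (a : 'I_n -> K) :
  (forall l, is_character (chi l)) -> separated chi ->
  (forall z, \sum_(l < n) a l * chi l z = 0) -> forall l, a l = 0.
Proof.
elim: n chi a => [chi a _ _ _ [] //|n IHn chi a chiP sep a0].
have aw l : a (widen_ord (leqnSn n) l) = 0.
  have [h hl] := separated_last sep l.
  have zero z : \sum_(l < n) a (widen_ord (leqnSn n) l) *
      (chi (widen_ord (leqnSn n) l) h - chi ord_max h) *
      chi (widen_ord (leqnSn n) l) z = 0.
    have /(congr1 (@^~ z)) /= <- := diffop_sum_last h a chiP.
    by rewrite /diffop !a0 mulr0 subrr.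
  have /eqP := IHn _ _ (fun l => chiP _) (separated_widen sep) zero l.
  by rewrite mulf_eq0 subr_eq0 (negPf hl) orbF => /eqP.
have am : a ord_max = 0.
  have := a0 0; rewrite big_ord_recr /= big1 => [|l _]; last by rewrite aw mul0r.
  by rewrite add0r (chiP _).1 mulr1.
move=> l; have [->//|ln] := eqVneq l ord_max.
have ltln : (l < n)%N by rewrite ltn_neqAle ln -ltnS ltn_ord.
by rewrite (_ : l = widen_ord (leqnSn n) (Ordinal ltln)) ?aw //; apply: val_inj.
Qed.

Lemma diffops_sum_eq0 n (chi : 'I_n -> V -> K) (h : 'I_n -> V) (c : 'I_n -> K) :
  (forall l, is_character (chi l)) ->
  forall z, (\big[comp/id]_(i < n) diffop (chi i) (h i))
    (fun z => \sum_(l < n) c l * chi l z) z = 0.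
Proof.
elim: n chi h c => [|n IHn] chi h c chiP z; first by rewrite !big_ord0.
by rewrite big_ord_recr /= diffop_sum_last // (IHn (fun l => chi (widen_ord _ l))).
Qed.

(** Two difference operators of the last character commute, so the coefficients
produced by the induction hypothesis, as functions of the step, are forced to
be multiples of [chi l h - chi ord_max h], which is the eigenvalue of the
operator on [chi l]; subtracting the corresponding combination leaves a multiple
of the last character. The steps are nonzero because those are the vectors of
the form [t *: v] with [0 < t] and [v] of norm one. *)
Lemma exp_sum_of_diffops_eq0 n (chi : 'I_n -> V -> K) F :
  (forall l, is_character (chi l)) -> separated chi ->
  (forall h : 'I_n -> V, (forall i, h i != 0) ->
     forall z, (\big[comp/id]_(i < n) diffop (chi i) (h i)) F z = 0) ->
  exists c : 'I_n -> K, forall z, F z = \sum_(l < n) c l * chi l z.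
Proof.
elim: n chi F => [|n IHn] chi F chiP sep F0.
  exists (fun=> 0) => z; rewrite big_ord0.
  by have := F0 (fun=> 0) (fun i => False_ind _ (notF (ltn_ord i))) z; rewrite big_ord0.
pose w := widen_ord (leqnSn n).
have wE l : w l = lift ord_max l by apply: val_inj; rewrite /= /bump leqNgt ltn_ord.
have /choice[c cP] k : exists c : 'I_n -> K,
    diffop (chi ord_max) k F = fun z => \sum_(l < n) c l * chi (w l) z.
  (* The step 0 is outside the hypothesis, but its operator is zero. *)
  have [->|k0] := eqVneq k 0.
    exists (fun=> 0); rewrite diffop0 //; apply/funext => z.
    by rewrite big1 // => l _; rewrite mul0r.
  have [h h0 z|c cP] := IHn (fun l => chi (w l)) (diffop (chi ord_max) k F)
      (fun l => chiP _) (separated_widen sep).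
    pose h' i := if unlift ord_max i is Some j then h j else k.
    have h'0 i : h' i != 0 by rewrite /h'; case: unliftP.
    have := F0 h' h'0 z; rewrite big_ord_recr /= {2}/h' unlift_none.
    rewrite (eq_bigr (fun i => diffop (chi (w i)) (h i))) // => i _.
    by rewrite -/(w i) /h' wE liftK.
  by exists c; apply/funext.
have cC h k l : c h l * (chi (w l) k - chi ord_max k) =
                c k l * (chi (w l) h - chi ord_max h).
  apply/eqP; rewrite -subr_eq0; apply/eqP; move: l.
  apply: (character_free (fun l => chiP (w l)) (separated_widen sep)) => z.
  have /(congr1 (@^~ z)) := diffopC (chi ord_max) k h F.
  rewrite !cP !diffop_sum //= => /eqP; rewrite -subr_eq0 -sumrB => /eqP E0.
  by rewrite -[RHS]E0; apply: eq_bigr => l _; rewrite mulrBl.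
(* Evaluating [cC] at a step that separates [chi (w l)] from the last character
   makes the factor of proportionality explicit. *)
have /choice[k kP] := separated_last sep.
pose d l := c (k l) l / (chi (w l) (k l) - chi ord_max (k l)).
have cd h l : c h l = d l * (chi (w l) h - chi ord_max h).
  by rewrite /d mulrAC -cC mulfK // subr_eq0 kP.
pose H z := F z - \sum_(l < n) d l * chi (w l) z.
have HE : forall z, H z = H 0 * chi ord_max z.
  apply: diffop_all_eq0 => h z.
  have /(congr1 (@^~ z)) /= := cP h; under eq_bigr => l _ do rewrite cd.
  have /(congr1 (@^~ z)) /= <- := diffop_sum (chi ord_max) h d (fun l => chiP (w l)).
  by rewrite /diffop /H => /eqP; rewrite -subr_eq0 => /eqP E0; rewrite -[RHS]E0; ring.
exists (fun i => if unlift ord_max i is Some j then d j else H 0) => z.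
rewrite big_ord_recr /= unlift_none -HE /H addrC.
rewrite [X in _ + X](_ : _ = \sum_(l < n) d l * chi (w l) z) ?subrK //.
by apply: eq_bigr => l _; rewrite -/(w l) {1}wE liftK.
Qed.

End Characters.

(** * Exponentials as characters of the plane *)

Lemma cexp0 (R : realType) : cexp (0 : R[i]) = 1.
Proof. by rewrite /cexp /= expR0 cos0 sin0 mulr1 mulr0. Qed.

Lemma cexpD (R : realType) (x y : R[i]) : cexp (x + y) = cexp x * cexp y.
Proof.
case: x y => [a b] [c d]; rewrite /cexp /= expRD cosD sinD.
by apply/eqP; rewrite eq_complex /=; apply/andP; split; apply/eqP; ring.
Qed.

(** At [t = 1] the modulus gives [expR (Re z) = 1]; the argument is then settled
by a [t] that turns the angle [Im z * t] into [pi]. *)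
Lemma cexp_line_eq1 (R : realType) (z : R[i]) :
  (forall t : R, cexp (z * t%:C) = 1) -> z = 0.
Proof.
case: z => a b e1.
have E1E2 t : expR (a * t) * cos (b * t) = 1 /\ expR (a * t) * sin (b * t) = 0.
  by have := e1 t; rewrite /cexp /= !mulr0 subr0 add0r => -[-> ->].
have a0 : a = 0.
  have [] := E1E2 1; rewrite mulr1 => c1 s1.
  apply: expR_inj; rewrite expR0; apply/eqP.
  rewrite -(@eqrXn2 _ 2) ?expR_ge0 // expr1n.
  have <- : (expR a * cos (b * 1)) ^+ 2 + (expR a * sin (b * 1)) ^+ 2 = expR a ^+ 2.
    by rewrite !exprMn -mulrDr cos2Dsin2 mulr1.
  by rewrite c1 s1 expr1n expr0n addr0.
have [->|b0] := eqVneq b 0; first by rewrite a0.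
have [] := E1E2 (pi / b); rewrite a0 mul0r expR0 mul1r mulrC divfK // cospi => /eqP.
by rewrite eqNr oner_eq0.
Qed.

Section Plane.
Variable R : realType.
Implicit Types (g : 'cV[R[i]]_2) (v z : 'cV[R]_2).

Lemma cdotDr g v z : cdot g (v + z) = cdot g v + cdot g z.
Proof. by rewrite /cdot map_mxD mulmxDr mxE. Qed.

Lemma cdotBl g g' z : cdot (g - g') z = cdot g z - cdot g' z.
Proof. by rewrite /cdot linearB /= mulmxBl !mxE. Qed.

Lemma cdotZr g (t : R) v : cdot g (t *: v) = cdot g v * t%:C.
Proof. by rewrite /cdot map_mxZ -scalemxAr mxE mulrC. Qed.

Lemma cdot_delta g j : cdot g (delta_mx j 0) = g j 0.
Proof.
rewrite /cdot map_delta_mx mxE (bigD1 j) //= big1 => [|k kj].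
  by rewrite !mxE !eqxx mulr1 addr0.
by rewrite !mxE (negPf kj) mulr0.
Qed.

Definition planechar g : 'cV[R]_2 -> R[i] := fun z => cexp (cdot g z).

Lemma planechar_character g : is_character (planechar g).
Proof.
split=> [|v z]; last by rewrite /planechar cdotDr cexpD.
by rewrite /planechar -[0 : 'cV__](scale0r 0) cdotZr mulr0 cexp0.
Qed.

(** If two of these characters agree everywhere, their quotient is trivial on
both coordinate axes, so the exponents agree in each coordinate. *)
Lemma planechar_inj : injective planechar.
Proof.
move=> g g' gg'; apply/eqP; rewrite -subr_eq0; apply/eqP/colP => j.
rewrite [RHS]mxE -cdot_delta; apply: cexp_line_eq1 => t.
rewrite -cdotZr; set z := t *: _.
have e1 : cexp (cdot (g - g') z) * cexp (cdot g' z) = cexp (cdot g' z).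
  by rewrite -cexpD cdotBl subrK; have /(congr1 (@^~ z)) := gg'.
have n0 : cexp (cdot g' z) != 0.
  apply/eqP => z0; have := cexp0 R.
  by rewrite -(subrr (cdot g' z)) cexpD z0 mul0r => /eqP; rewrite eq_sym oner_eq0.
by apply: (mulIf n0); rewrite mul1r.
Qed.

Lemma DeltaE g v (t : R) : Delta g v t = diffop (planechar g) (t *: v).
Proof.
by apply/funext => F; apply/funext => z; rewrite /Delta /diffop /planechar cdotZr.
Qed.

Lemma enorm_gt0 v : v != 0 -> 0 < enorm v.
Proof.
move=> v0; rewrite sqrtr_gt0 lt0r sumr_ge0 ?andbT => [|i _]; last exact: sqr_ge0.
apply: contraNneq v0 => /eqP; rewrite psumr_eq0 => [/allP v0|i _]; last exact: sqr_ge0.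
apply/eqP/colP => i; rewrite mxE; apply/eqP.
by have := v0 i (mem_index_enum i); rewrite sqrf_eq0.
Qed.

Lemma enormZ (t : R) v : enorm (t *: v) = `|t| * enorm v.
Proof.
rewrite /enorm -sqrtr_sqr -sqrtrM ?sqr_ge0 // mulr_sumr.
by congr Num.sqrt; apply: eq_bigr => i _; rewrite mxE exprMn.
Qed.

End Plane.

Theorem theorem2p5 (R : realType) (n : nat) (hn : (1 <= n)%N)
    (gam : 'I_n -> 'cV[R[i]]_2)
    (gamD : forall (l : 'I_n) (j : 'I_2), inD (gam l j 0))
    (gam_distinct : forall k l : 'I_n, k <> l -> gam k <> gam l)
    (F : 'cV[R]_2 -> R[i]) :
  (forall (t : 'I_n -> R) (v : 'I_n -> 'cV[R]_2),
     (forall i : 'I_n, 0 < t i) ->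
     (forall i : 'I_n, enorm (v i) = 1) ->
     forall z : 'cV[R]_2,
       (\big[comp/id]_(i < n) Delta (gam i) (v i) (t i)) F z = 0)
  <->
  (exists c : 'I_n -> R[i],
     forall z : 'cV[R]_2, F z = \sum_(l < n) c l * cexp (cdot (gam l) z)).
Proof.
have chiP l : is_character (planechar (gam l)) := planechar_character _.
have sep : separated (fun l => planechar (gam l)).
  move=> k l kl; apply: contrapT => same; apply: (gam_distinct _ _ kl).
  apply/planechar_inj/funext => h; apply/eqP/negPn/negP => ne.
  by apply: same; exists h.
split=> [F0|[c Fc] t v _ _ z].
  apply: (exp_sum_of_diffops_eq0 chiP sep) => h h0 z.
  have t0 i : 0 < enorm (h i) := enorm_gt0 (h0 i).
  have v1 i : enorm ((enorm (h i))^-1 *: h i) = 1.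
    by rewrite enormZ gtr0_norm ?invr_gt0 ?t0 // mulVf // gt_eqF ?t0.
  rewrite -{}[RHS](F0 _ _ t0 v1 z); congr (_ F z); apply: eq_bigr => i _.
  by rewrite DeltaE scalerA divff ?scale1r // gt_eqF ?t0.
rewrite (eq_bigr _ (fun i _ => DeltaE _ _ _)) (funext Fc).
exact: (diffops_sum_eq0 _ _ chiP).
Qed.
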